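(* Let $PV_3$ be the group with generators $\lambda_{12},\lambda_{21},\lambda_{13},\lambda_{31},\lambda_{23},\lambda_{32}$ and the six defining relations $\lambda_{ki}\lambda_{kj}\lambda_{ij}=\lambda_{ij}\lambda_{kj}\lambda_{ki}$ for every ordering $(k,i,j)$ of the three distinct indices $1,2,3$. Then $PV_3$ is residually torsion-free nilpotent.
   Context: $PV_3$ is the pure virtual braid group on three strands; the presentation above may be taken as its definition. A group $G$ is residually torsion-free nilpotent if for every $1\neq g\in G$ there is a normal subgroup $N$ with $g\notin N$ and $G/N$ torsion-free nilpotent. *)

(* Defs.v *)
From Stdlib Require Import List.
Import ListNotations.

Inductive Idx : Type := I1 | I2 | I3.

Inductive Gen : Type := l12 | l21 | l13 | l31 | l23 | l32.

(** lambda_ij; the diagonal values are never used (only applied to i <> j). *)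
Definition lam (i j : Idx) : Gen :=
  match i, j with
  | I1, I2 => l12 | I2, I1 => l21 | I1, I3 => l13
  | I3, I1 => l31 | I2, I3 => l23 | I3, I2 => l32
  | _, _ => l12
  end.

(** Words in the generators and their inverses: (x, false) = x, (x, true) = x^-1. *)
Definition word := list (Gen * bool).

Definition letter (x : Gen) : word := [(x, false)].

Definition rel_lhs (k i j : Idx) : word :=
  letter (lam k i) ++ letter (lam k j) ++ letter (lam i j).
Definition rel_rhs (k i j : Idx) : word :=
  letter (lam i j) ++ letter (lam k j) ++ letter (lam k i).

Inductive pv3_eq : word -> word -> Prop :=
| pv3_refl w : pv3_eq w w
| pv3_sym u v : pv3_eq u v -> pv3_eq v u
| pv3_trans u v w : pv3_eq u v -> pv3_eq v w -> pv3_eq u w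
| pv3_cancel u v x b :
    pv3_eq (u ++ (x, b) :: (x, negb b) :: v) (u ++ v)
| pv3_rel u v k i j :
    k <> i -> k <> j -> i <> j ->
    pv3_eq (u ++ rel_lhs k i j ++ v) (u ++ rel_rhs k i j ++ v).

Record Grp : Type := {
  car :> Type;
  gmul : car -> car -> car;
  ginv : car -> car;
  gone : car;
  gmulA : forall x y z, gmul x (gmul y z) = gmul (gmul x y) z;
  gmul1 : forall x, gmul gone x = x;
  gmulV : forall x, gmul (ginv x) x = gone
}.

Arguments gmul {g}.
Arguments ginv {g}.
Arguments gone {g}.

Definition comm {G : Grp} (x y : G) : G :=
  gmul (gmul (ginv x) (ginv y)) (gmul x y).

Fixpoint gpow {G : Grp} (x : G) (n : nat) : G :=
  match n with 0 => gone | S n => gmul x (gpow x n) end.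

Inductive gen_sub {G : Grp} (S : G -> Prop) : G -> Prop :=
| gs_base x : S x -> gen_sub S x
| gs_one : gen_sub S gone
| gs_mul x y : gen_sub S x -> gen_sub S y -> gen_sub S (gmul x y)
| gs_inv x : gen_sub S x -> gen_sub S (ginv x).

(** Lower central series: lcs 0 = gamma_1(G) = G,
    lcs (n+1) = gamma_{n+2}(G) = [gamma_{n+1}(G), G]. *)
Fixpoint lcs {G : Grp} (n : nat) : G -> Prop :=
  match n with
  | 0 => fun _ => True
  | S n => gen_sub (fun z => exists x y, lcs n x /\ z = comm x y)
  end.

Definition nilpotent (G : Grp) : Prop :=
  exists c, forall x : G, lcs c x -> x = gone.

Definition torsion_free (G : Grp) : Prop :=
  forall (x : G) (n : nat), 0 < n -> gpow x n = gone -> x = gone.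

Fixpoint eval {G : Grp} (f : Gen -> G) (w : word) : G :=
  match w with
  | [] => gone
  | (x, b) :: w' => gmul (if b then ginv (f x) else f x) (eval f w')
  end.

(** f : Gen -> G defines a homomorphism PV_3 -> G (it respects the relations). *)
Definition respects_rels {G : Grp} (f : Gen -> G) : Prop :=
  forall k i j, k <> i -> k <> j -> i <> j ->
    eval f (rel_lhs k i j) = eval f (rel_rhs k i j).

(* Main.v *)
(* A group G is residually torsion-free nilpotent as soon as its integer-valued polynomial
   functions, those killed by k successive differences (degree < k), separate its elements:
   the elements acting alike on all polynomials of degree < k define a quotient that is nilpotent,
   since differences along n-fold commutators lower degrees by n, and torsion-free, since g^n acts as
   1 + n(g - 1) once (g - 1)^2 = 0.

   The property is inherited by F x| Q when Q acts on F by automorphisms trivial on the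
   abelianization (extend polynomials from F and pull them back from Q), and by G * Z (sum products
   of polynomials on G over the subwords of a normal form); hence it holds for free groups.

   It remains to decompose PV_3. Around a hexagon x0, ..., x5 = l12, l13, l23, l21, l31, l32, the
   defining relations are x_i x_(i+1) x_(i+2) = x_(i+2) x_(i+1) x_i, and they are preserved by
   x_i -> x_i t for even i, x_i -> t^-1 x_i for odd i. Splitting off t = x0 gives
   PV_3 = (F(u,v,c) x| F(q,w)) * <t>, where x1 = t^-1 c q, x2 = (cq)^-1 u t, x3 = t^-1 w,
   x4 = v q^-1 t, x5 = t^-1 q. *)

From Stdlib Require Import List ZArith Lia Classical ClassicalEpsilon.
From Stdlib Require Import FunctionalExtensionality PropExtensionality ProofIrrelevance.
Require Import Defs.
Import ListNotations.

Declare Scope grp_scope.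
Notation "x ** y" := (gmul x y) (at level 40, left associativity) : grp_scope.
Notation "x ^-1" := (ginv x) (at level 29, left associativity) : grp_scope.
Open Scope grp_scope.

(** * Groups *)

Lemma gmulK {G : Grp} (x y : G) : x^-1 ** (x ** y) = y.
Proof. now rewrite gmulA, gmulV, gmul1. Qed.

Lemma gmul_cancel {G : Grp} (x y z : G) : x ** y = x ** z -> y = z.
Proof. intros H. rewrite <- (gmulK x y), H. apply gmulK. Qed.

Lemma gmulr1 {G : Grp} (x : G) : x ** gone = x.
Proof. apply (gmul_cancel (x^-1)). now rewrite gmulA, gmulV, gmul1. Qed.

Lemma gmulVr {G : Grp} (x : G) : x ** x^-1 = gone.
Proof. apply (gmul_cancel (x^-1)). now rewrite gmulA, gmulV, gmul1, gmulr1. Qed.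

Lemma gmulVK {G : Grp} (x y : G) : x ** (x^-1 ** y) = y.
Proof. now rewrite gmulA, gmulVr, gmul1. Qed.

Lemma ginv_unique {G : Grp} (x y : G) : x ** y = gone -> y = x^-1.
Proof. intros H. apply (gmul_cancel x). now rewrite H, gmulVr. Qed.

Lemma ginvK {G : Grp} (x : G) : x^-1^-1 = x.
Proof. symmetry. apply ginv_unique, gmulV. Qed.

Lemma ginv1 {G : Grp} : (gone : G)^-1 = gone.
Proof. symmetry. apply ginv_unique, gmul1. Qed.

Lemma ginvM {G : Grp} (x y : G) : (x ** y)^-1 = y^-1 ** x^-1.
Proof.
  symmetry. apply ginv_unique.
  now rewrite <- gmulA, gmulVK, gmulVr.
Qed.

Lemma gassoc {G : Grp} (x y z : G) : x ** y ** z = x ** (y ** z).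
Proof. symmetry. apply gmulA. Qed.

Hint Rewrite @gassoc @gmul1 @gmulr1 @gmulV @gmulVr @gmulK @gmulVK @ginvK @ginv1 @ginvM : grp.
Ltac grp := autorewrite with grp.

Definition hom {G L : Grp} (f : G -> L) : Prop := forall x y, f (x ** y) = f x ** f y.

Lemma hom1 {G L : Grp} (f : G -> L) : hom f -> f gone = gone.
Proof. intros H. apply (gmul_cancel (f gone)). now rewrite <- H, gmul1, gmulr1. Qed.

Lemma homV {G L : Grp} (f : G -> L) (x : G) : hom f -> f (x^-1) = (f x)^-1.
Proof. intros H. apply ginv_unique. now rewrite <- H, gmulVr, hom1. Qed.

Lemma hom_eval {G L : Grp} (h : G -> L) (f : Gen -> G) (w : word) :
  hom h -> h (eval f w) = eval (fun x => h (f x)) w.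
Proof.
  intros H. induction w as [|[x b] w IH]; simpl.
  - now apply hom1.
  - rewrite H, IH. now destruct b; [rewrite (homV h _ H)|].
Qed.

Definition trivial_group : Grp.
Proof. refine (Build_Grp unit (fun _ _ => tt) (fun _ => tt) tt _ _ _); now intros []. Defined.

(** * Quotients *)

Section Quotient.
Variables (T : Type) (m : T -> T -> T) (i : T -> T) (e : T) (R : T -> T -> Prop).
Hypothesis Rrefl : forall a, R a a.
Hypothesis Rsym : forall a b, R a b -> R b a.
Hypothesis Rtrans : forall a b c, R a b -> R b c -> R a c.
Hypothesis Rm : forall a a' b b', R a a' -> R b b' -> R (m a b) (m a' b').
Hypothesis RA : forall a b c, R (m a (m b c)) (m (m a b) c).
Hypothesis R1 : forall a, R (m e a) a.
Hypothesis RV : forall a, R (m (i a) a) e.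

(** Classes are predicates: with extensionality, related elements then have equal classes, as the
    laws of [Grp], stated with [=], require. *)
Definition quot_car : Type := {P : T -> Prop | exists a, P = R a}.

Definition cls (a : T) : quot_car := exist _ (R a) (ex_intro _ a eq_refl).

Definition rep (x : quot_car) : T :=
  proj1_sig (constructive_indefinite_description _ (proj2_sig x)).

Lemma cls_eq (a b : T) : R a b -> cls a = cls b.
Proof.
  intros H. apply subset_eq_compat, functional_extensionality. intros c.
  apply propositional_extensionality; split; eauto.
Qed.

Lemma cls_inj (a b : T) : cls a = cls b -> R a b.
Proof. intros H. apply (f_equal (fun x => proj1_sig x b)) in H. cbn in H. now rewrite H. Qed.

Lemma cls_rep (x : quot_car) : cls (rep x) = x.
Proof.
  destruct x as [P HP]. unfold rep. cbn.
  destruct constructive_indefinite_description as [a Ha]. cbn.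
  apply subset_eq_compat. now symmetry.
Qed.

Lemma rep_cls (a : T) : R (rep (cls a)) a.
Proof. apply cls_inj, cls_rep. Qed.

Definition quot : Grp.
Proof.
  refine (Build_Grp quot_car (fun x y => cls (m (rep x) (rep y))) (fun x => cls (i (rep x)))
            (cls e) _ _ _); intros x.
  - intros y z. apply cls_eq.
    eapply Rtrans; [apply Rm; [apply Rrefl|apply rep_cls]|].
    eapply Rtrans; [apply RA|]. apply Rm; [apply Rsym, rep_cls|apply Rrefl].
  - rewrite <- (cls_rep x) at 2. apply cls_eq.
    eapply Rtrans; [apply Rm; [apply rep_cls|apply Rrefl]|apply R1].
  - apply cls_eq. eapply Rtrans; [apply Rm; [apply rep_cls|apply Rrefl]|apply RV].
Defined.

Lemma cls_mul (a b : T) : (cls (m a b) : quot) = (cls a : quot) ** (cls b : quot).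
Proof. apply cls_eq, Rm; apply Rsym, rep_cls. Qed.

End Quotient.

(** * Polynomial functions on a group *)

Open Scope Z_scope.

Fixpoint Poly {G : Grp} (k : nat) (f : G -> Z) : Prop :=
  match k with
  | O => forall x, f x = 0
  | S k => forall g, Poly k (fun x => f (g ** x) - f x)
  end.

Lemma Poly_ext {G : Grp} k (f f' : G -> Z) : (forall x, f x = f' x) -> Poly k f -> Poly k f'.
Proof. intros H. now replace f' with f by now apply functional_extensionality. Qed.

Lemma Poly_add {G : Grp} k : forall f f' : G -> Z,
  Poly k f -> Poly k f' -> Poly k (fun x => f x + f' x).
Proof.
  induction k as [|k IH]; simpl; intros f f' H H'.
  - intros x. now rewrite H, H'.
  - intros g. refine (Poly_ext _ _ _ _ (IH _ _ (H g) (H' g))). intros; lia.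
Qed.

Lemma Poly_scale {G : Grp} k (n : Z) : forall f : G -> Z, Poly k f -> Poly k (fun x => n * f x).
Proof.
  induction k as [|k IH]; simpl; intros f H.
  - intros x. rewrite H. lia.
  - intros g. refine (Poly_ext _ _ _ _ (IH _ (H g))). intros; lia.
Qed.

Lemma Poly_sub {G : Grp} k (f f' : G -> Z) :
  Poly k f -> Poly k f' -> Poly k (fun x => f x - f' x).
Proof.
  intros H H'. refine (Poly_ext _ _ _ _ (Poly_add _ _ _ H (Poly_scale _ (-1) _ H'))). intros; lia.
Qed.

Lemma Poly_zero {G : Grp} k : Poly k (fun _ : G => 0).
Proof. induction k; simpl; auto. Qed.

Lemma Poly_S {G : Grp} k : forall f : G -> Z, Poly k f -> Poly (S k) f.
Proof.
  induction k as [|k IH]; intros f H.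
  - intros g x. simpl in H. now rewrite !H.
  - intros g. apply IH, H.
Qed.

Lemma Poly_le {G : Grp} k k' (f : G -> Z) : (k <= k')%nat -> Poly k f -> Poly k' f.
Proof. induction 1; auto using Poly_S. Qed.

Lemma Poly_translate {G : Grp} k (g : G) (f : G -> Z) : Poly k f -> Poly k (fun x => f (g ** x)).
Proof.
  intros H. refine (Poly_ext _ _ _ _ (Poly_add _ _ _ (Poly_S _ _ H g) H)). intros; lia.
Qed.

Lemma Poly_hom {G L : Grp} (h : G -> L) k : hom h ->
  forall f : L -> Z, Poly k f -> Poly k (fun x => f (h x)).
Proof.
  intros Hh. induction k as [|k IH]; simpl; intros f H.
  - auto.
  - intros g. refine (Poly_ext _ _ _ _ (IH _ (H (h g)))). intros x. simpl. now rewrite Hh.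
Qed.

Lemma Poly_const {G : Grp} (n : Z) : Poly 1 (fun _ : G => n).
Proof. simpl. intros; lia. Qed.

Lemma Poly1_const {G : Grp} (f : G -> Z) (x : G) : Poly 1 f -> f x = f gone.
Proof. intros H. specialize (H x gone). simpl in H. rewrite gmulr1 in H. lia. Qed.

(** With [Poly_diff_inv]: the elements along which [f] has a difference of index [k] form a
    subgroup, so generators suffice. *)
Lemma Poly_diff_mul {G : Grp} k (f : G -> Z) (a b : G) :
  Poly k (fun x => f (a ** x) - f x) -> Poly k (fun x => f (b ** x) - f x) ->
  Poly k (fun x => f (a ** b ** x) - f x).
Proof.
  intros Ha Hb.
  refine (Poly_ext _ _ _ _ (Poly_add _ _ _ (Poly_translate _ b _ Ha) Hb)).
  intros x. cbv beta. rewrite gmulA. lia.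
Qed.

Lemma Poly_diff_inv {G : Grp} k (f : G -> Z) (a : G) :
  Poly k (fun x => f (a ** x) - f x) -> Poly k (fun x => f (a^-1 ** x) - f x).
Proof.
  intros Ha.
  refine (Poly_ext _ _ _ _ (Poly_scale _ (-1) _ (Poly_translate _ (a^-1) _ Ha))).
  intros x. cbv beta. rewrite gmulVK. lia.
Qed.

(** In the group ring, ab - ba = (a - 1)(b - 1) - (b - 1)(a - 1). *)
Lemma Poly_diff_swap {G : Grp} k (f : G -> Z) (a b : G) :
  Poly k (fun x => (f (a ** (b ** x)) - f (b ** x)) - (f (a ** x) - f x)) ->
  Poly k (fun x => (f (b ** (a ** x)) - f (a ** x)) - (f (b ** x) - f x)) ->
  Poly k (fun x => f (a ** b ** x) - f (b ** a ** x)).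
Proof.
  intros Ha Hb. refine (Poly_ext _ _ _ _ (Poly_sub _ _ _ Ha Hb)).
  intros x. cbv beta. rewrite !gmulA. lia.
Qed.

Definition poly_separated (G : Grp) : Prop :=
  forall g : G, g <> gone -> exists k f, Poly k f /\ f g <> f gone.

(** * Torsion-free nilpotent quotients *)

Section PolyQuotient.
Variables (G : Grp) (k : nat).

Definition poly_eq (a b : G) : Prop :=
  forall f, Poly k f -> forall x, f (a ** x) = f (b ** x).

Lemma poly_eq_mul a a' b b' : poly_eq a a' -> poly_eq b b' -> poly_eq (a ** b) (a' ** b').
Proof.
  intros Ha Hb f Hf x. rewrite !gassoc, (Ha f Hf).
  exact (Hb _ (Poly_translate _ a' _ Hf) x).
Qed.

Lemma poly_eq_refl a : poly_eq a a.
Proof. now intros f Hf x. Qed.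

Lemma poly_eq_sym a b : poly_eq a b -> poly_eq b a.
Proof. intros H f Hf x. symmetry. now apply H. Qed.

Lemma poly_eq_trans a b c : poly_eq a b -> poly_eq b c -> poly_eq a c.
Proof. intros H H' f Hf x. now rewrite (H f Hf), (H' f Hf). Qed.

Definition poly_quot : Grp.
Proof.
  refine (quot G gmul ginv gone poly_eq poly_eq_refl poly_eq_sym poly_eq_trans poly_eq_mul _ _ _);
    intros; intros f Hf x; now grp.
Defined.

Definition pcls (g : G) : poly_quot := cls G poly_eq g.

Lemma pcls_hom : hom pcls.
Proof. intros a b. apply cls_mul. Qed.

Lemma pcls_surj (x : poly_quot) : exists g, pcls g = x.
Proof. exists (rep G poly_eq x). apply cls_rep. Qed.

Lemma pcls_eq (a b : G) : pcls a = pcls b <-> poly_eq a b.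
Proof.
  split; [apply cls_inj, poly_eq_refl|apply cls_eq; [apply poly_eq_sym|apply poly_eq_trans]].
Qed.

Lemma pcls_gpow (g : G) n : pcls (gpow g n) = gpow (pcls g) n.
Proof.
  induction n; simpl; [exact (hom1 _ pcls_hom)|]. now rewrite pcls_hom, IHn.
Qed.

Lemma poly_quot_torsion_free : torsion_free poly_quot.
Proof.
  intros x n Hn Hx. destruct (pcls_surj x) as [g <-].
  rewrite <- pcls_gpow in Hx.
  change gone with (pcls gone) in Hx |- *. apply pcls_eq in Hx. apply pcls_eq.
  enough (H : forall j, (j <= k)%nat -> forall f, Poly j f -> forall x, f (g ** x) = f x).
  { intros f Hf x. rewrite gmul1. apply (H k); auto. }
  induction j as [|j IH]; intros Hj f Hf x.
  - simpl in Hf. now rewrite !Hf.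
  - pose proof (IH ltac:(lia) _ (Hf g)) as IHd. simpl in IHd.
    (* By induction [g] fixes the difference f(gx) - f(x), so [f] is affine along powers of [g];
       since g^n fixes [f], the slope vanishes. *)
    assert (L : forall i y, f (gpow g i ** y) = f y + Z.of_nat i * (f (g ** y) - f y)).
    { induction i as [|i IHi]; intros y; simpl gpow.
      - rewrite gmul1. lia.
      - rewrite gassoc.
        assert (E : f (g ** (gpow g i ** y)) - f (gpow g i ** y) = f (g ** y) - f y).
        { clear IHi. induction i as [|i IHi]; simpl gpow.
          - now rewrite gmul1.
          - rewrite gassoc, <- IHi. apply IHd. }
        rewrite IHi in E. lia. }
    specialize (L n x).
    rewrite (Hx f (Poly_le _ _ _ Hj Hf)), gmul1 in L.
    assert (E : Z.of_nat n * (f (g ** x) - f x) = 0) by lia.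
    apply Z.mul_eq_0 in E. lia.
Qed.

(** Induction on [n]: the commutator of an element lowering the index by n + 1 with any element
    lowers it by n + 2. *)
Lemma poly_quot_lcs n : forall x : poly_quot, lcs n x ->
  exists g, pcls g = x /\
    forall j f, Poly (j + S n) f -> Poly j (fun x => f (g ** x) - f x).
Proof.
  induction n as [|n IH].
  - intros x _. destruct (pcls_surj x) as [g <-]. exists g. split; auto.
    intros j f Hf. replace (j + 1)%nat with (S j) in Hf by lia. apply Hf.
  - intros x Hx. induction Hx as [x (y & z & Hy & ->)| |x y _ (g & <- & Hg) _ (h & <- & Hh)
      |x _ (g & <- & Hg)].
    + destruct (IH y Hy) as (g & <- & Hg). destruct (pcls_surj z) as [h <-].
      exists (comm g h). split.
      { unfold comm. now rewrite !pcls_hom, !homV by apply pcls_hom. }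
      intros j f Hf.
      (* Translating by (hg)^-1 turns f([g,h]x) - f(x) into F(ghx) - F(hgx), to which
         [Poly_diff_swap] applies. *)
      set (F := fun x => f ((h ** g)^-1 ** x)).
      assert (HF : Poly (j + S (S n)) F) by now apply Poly_translate.
      assert (H : Poly j (fun x => F (g ** h ** x) - F (h ** g ** x))).
      { apply Poly_diff_swap.
        - apply (Hg (S j) F). now replace (S j + S n)%nat with (j + S (S n))%nat by lia.
        - apply (Hg j (fun x => F (h ** x) - F x)).
          replace (j + S (S n))%nat with (S (j + S n)) in HF by lia. apply HF. }
      refine (Poly_ext _ _ _ _ H). intros x. unfold F, comm. now grp.
    + exists gone. split; [exact (hom1 _ pcls_hom)|]. intros j f Hf.
      apply (Poly_ext _ (fun _ => 0)); [intros; rewrite gmul1; lia|apply Poly_zero].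
    + exists (g ** h). split; [apply pcls_hom|]. intros j f Hf.
      apply Poly_diff_mul; auto.
    + exists (g^-1). split; [exact (homV _ _ pcls_hom)|]. intros j f Hf.
      apply Poly_diff_inv; auto.
Qed.

End PolyQuotient.

Theorem poly_quot_nilpotent (G : Grp) (k : nat) : nilpotent (poly_quot G k).
Proof.
  exists k. intros x Hx. apply poly_quot_lcs in Hx as (g & <- & Hg).
  change gone with (pcls G k gone). apply pcls_eq. intros f Hf x.
  specialize (Hg 0%nat f (Poly_S _ _ Hf) x). simpl in Hg. rewrite gmul1. lia.
Qed.

(** * Semidirect products *)

(* Equality in the abelianization, seen through polynomial functions: such elements act alike on
   polynomials up to a drop of the degree by two. *)
Definition abeq {G : Grp} (a b : G) : Prop :=
  forall k f, Poly (S (S k)) f -> Poly k (fun x => f (a ** x) - f (b ** x)).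

Lemma abeq_refl {G : Grp} (a : G) : abeq a a.
Proof.
  intros k f _. apply (Poly_ext _ (fun _ => 0)); [intros; lia|apply Poly_zero].
Qed.

Lemma abeq_sym {G : Grp} (a b : G) : abeq a b -> abeq b a.
Proof.
  intros H k f Hf. refine (Poly_ext _ _ _ _ (Poly_scale _ (-1) _ (H k f Hf))). intros; lia.
Qed.

Lemma abeq_trans {G : Grp} (a b c : G) : abeq a b -> abeq b c -> abeq a c.
Proof.
  intros H H' k f Hf. refine (Poly_ext _ _ _ _ (Poly_add _ _ _ (H k f Hf) (H' k f Hf))).
  intros; lia.
Qed.

Lemma abeq_mul {G : Grp} (a a' b b' : G) : abeq a a' -> abeq b b' -> abeq (a ** b) (a' ** b').
Proof.
  intros H H' k f Hf.
  refine (Poly_ext _ _ _ _ (Poly_add _ _ _ (Poly_translate _ b _ (H k f Hf))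
    (H' k _ (Poly_translate _ a' _ Hf)))).
  intros x. cbv beta. rewrite !gassoc. lia.
Qed.

Lemma abeq_inv {G : Grp} (a b : G) : abeq a b -> abeq (a^-1) (b^-1).
Proof.
  intros H. apply abeq_sym.
  pose proof (abeq_mul _ _ _ _ (abeq_refl (a^-1)) (abeq_mul _ _ _ _ H (abeq_refl (b^-1)))) as E.
  revert E. now grp.
Qed.

(** Both products of differences in [Poly_diff_swap] lower the degree by two. *)
Lemma abeq_comm {G : Grp} (a b : G) : abeq (a ** b) (b ** a).
Proof.
  intros k f Hf. apply Poly_diff_swap; [apply (Hf a b)|apply (Hf b a)].
Qed.

Lemma abeq_conj {G : Grp} (a b : G) : abeq (a^-1 ** b ** a) b.
Proof.
  pose proof (abeq_comm (a^-1) (b ** a)) as E. revert E. now grp.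
Qed.

Definition IA {G : Grp} (f : G -> G) : Prop := forall x, abeq (f x) x.

(** The difference of f(hx) - f(x) along g is D(hx) - D(x) + f(h(g)x) - f(gx), with D the difference
    of [f] along h(g). Induction handles the first part, [IA] the second. *)
Lemma Poly_IA {G : Grp} (h : G -> G) : hom h -> IA h ->
  forall k f, Poly (S k) f -> Poly k (fun x => f (h x) - f x).
Proof.
  intros Hh HI. induction k as [|k IH]; intros f Hf.
  - intros x. rewrite (Poly1_const f (h x) Hf), (Poly1_const f x Hf). lia.
  - intros g.
    refine (Poly_ext _ _ _ _ (Poly_add _ _ _ (IH _ (Hf (h g))) (HI g k f Hf))).
    intros x. cbv beta. rewrite Hh. lia.
Qed.

Record IAut (F : Grp) : Type := {
  ia_fun :> F -> F;
  ia_inv : F -> F;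
  ia_hom : hom ia_fun;
  ia_inv_hom : hom ia_inv;
  ia_funK : forall x, ia_fun (ia_inv x) = x;
  ia_invK : forall x, ia_inv (ia_fun x) = x;
  ia_IA : IA ia_fun;
  ia_inv_IA : IA ia_inv
}.
Arguments ia_inv {F}.

Lemma IAut_ext {F : Grp} (a b : IAut F) : (forall x, a x = b x) -> a = b.
Proof.
  intros H.
  assert (H' : ia_inv a = ia_inv b).
  { apply functional_extensionality. intros x.
    rewrite <- (ia_funK _ b x) at 1. now rewrite <- H, ia_invK. }
  destruct a, b. cbn in H, H'. apply functional_extensionality in H. subst.
  f_equal; apply proof_irrelevance.
Qed.

Definition IAut_mul {F : Grp} (a b : IAut F) : IAut F.
Proof.
  refine (Build_IAut F (fun x => a (b x)) (fun x => ia_inv b (ia_inv a x)) _ _ _ _ _ _);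
    [intros x y|intros x y|intros x|intros x|intros x|intros x].
  - now rewrite !ia_hom.
  - now rewrite !ia_inv_hom.
  - now rewrite !ia_funK.
  - now rewrite !ia_invK.
  - eapply abeq_trans; apply ia_IA.
  - eapply abeq_trans; apply ia_inv_IA.
Defined.

Definition IAut_inv {F : Grp} (a : IAut F) : IAut F :=
  Build_IAut F (ia_inv a) a (ia_inv_hom _ a) (ia_hom _ a) (ia_invK _ a) (ia_funK _ a)
    (ia_inv_IA _ a) (ia_IA _ a).

Definition IAut_one (F : Grp) : IAut F :=
  Build_IAut F (fun x => x) (fun x => x) (fun _ _ => eq_refl) (fun _ _ => eq_refl)
    (fun _ => eq_refl) (fun _ => eq_refl) (@abeq_refl F) (@abeq_refl F).

Definition IAut_grp (F : Grp) : Grp.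
Proof.
  refine (Build_Grp (IAut F) IAut_mul IAut_inv (IAut_one F) _ _ _); intros; apply IAut_ext;
    intros; cbn; auto using ia_invK.
Defined.

Section Semidirect.
Variables (F Q : Grp) (act : Q -> IAut_grp F).
Hypothesis act_hom : hom act.

Definition act_fun (q : Q) : F -> F := ia_fun F (act q).

Lemma act_mulF q x y : act_fun q (x ** y) = act_fun q x ** act_fun q y.
Proof. apply ia_hom. Qed.

Lemma act_mulQ q r x : act_fun (q ** r) x = act_fun q (act_fun r x).
Proof. unfold act_fun. now rewrite act_hom. Qed.

Lemma act_oneQ x : act_fun gone x = x.
Proof. unfold act_fun. now rewrite (hom1 act act_hom). Qed.

Lemma act_invF q x : act_fun q (x^-1) = (act_fun q x)^-1.
Proof. apply homV, ia_hom. Qed.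

Definition semidirect : Grp.
Proof.
  refine (Build_Grp (F * Q) (fun x y => (fst x ** act_fun (snd x) (fst y), snd x ** snd y))
    (fun x => (act_fun ((snd x)^-1) ((fst x)^-1), (snd x)^-1)) (gone, gone) _ _ _).
  - intros [x q] [y r] [z s]; cbn. now rewrite act_mulF, act_mulQ, !gmulA.
  - intros [x q]; cbn. now rewrite act_oneQ, !gmul1.
  - intros [x q]; cbn. now rewrite act_invF, !gmulV.
Defined.

Definition sd_left (x : F) : semidirect := (x, gone).
Definition sd_right (q : Q) : semidirect := (gone, q).

Lemma sd_left_hom : hom sd_left.
Proof. intros x y. unfold sd_left; cbn. now rewrite act_oneQ, gmul1. Qed.

Lemma sd_right_left q x : sd_right q ** sd_left x = sd_left (act_fun q x) ** sd_right q.
Proof. unfold sd_right, sd_left; cbn. now rewrite act_oneQ, gmulr1, !gmul1, gmulr1. Qed.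

Lemma sd_lift_hom (L : Grp) (al : F -> L) (be : Q -> L) : hom al -> hom be ->
  (forall q x, be q ** al x = al (act_fun q x) ** be q) ->
  hom (fun x : semidirect => al (fst x) ** be (snd x)).
Proof.
  intros Ha Hb H [x q] [y r]; cbn. rewrite Ha, Hb, !gassoc.
  f_equal. now rewrite !gmulA, H.
Qed.

(** The difference along (y, q) at (z, r) is (f(y q(z)) - f(q(z))) + (f(q(z)) - f(z)); as q acts by
    an IA-automorphism, both parts have lower degree in z. *)
Lemma Poly_semidirect k : forall f : F -> Z, Poly k f -> Poly k (fun x : semidirect => f (fst x)).
Proof.
  induction k as [|k IH]; intros f Hf; [intros x; apply Hf|].
  intros [y q].
  pose proof (Poly_add _ _ _ (Poly_hom _ k (ia_hom _ (act q)) _ (Hf y))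
    (Poly_IA _ (ia_hom _ (act q)) (ia_IA _ (act q)) k f Hf)) as H.
  refine (Poly_ext _ _ _ _ (IH _ H)).
  intros [z r]. cbn. unfold act_fun. lia.
Qed.

Lemma semidirect_poly_separated :
  poly_separated F -> poly_separated Q -> poly_separated semidirect.
Proof.
  intros HF HQ [x q] Hx. destruct (classic (q = gone)) as [->|Hq].
  - destruct (HF x) as (k & f & Hf & E); [intros ->; now apply Hx|].
    exists k, (fun x : semidirect => f (fst x)). split; [now apply Poly_semidirect|easy].
  - destruct (HQ q Hq) as (k & f & Hf & E).
    exists k, (fun x : semidirect => f (snd x)). split; [|easy].
    now apply (Poly_hom (fun x : semidirect => snd x)).
Qed.

End Semidirect.

(** * Free products with an infinite cyclic group *)

Section FreeProduct.
Variable G : Grp.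

(* [inr false] is the generator of the infinite cyclic factor, [inr true] its inverse. *)
Notation fword := (list (G + bool)).

(** A presentation of G * Z. The rules act at the front of a word and [fp_cons] carries them inward,
    which suits invariants defined by recursion on words. *)
Inductive fp_eq : fword -> fword -> Prop :=
| fp_refl w : fp_eq w w
| fp_sym u v : fp_eq u v -> fp_eq v u
| fp_trans u v w : fp_eq u v -> fp_eq v w -> fp_eq u w
| fp_cons a u v : fp_eq u v -> fp_eq (a :: u) (a :: v)
| fp_mul g h w : fp_eq (inl g :: inl h :: w) (inl (g ** h) :: w)
| fp_one w : fp_eq (inl gone :: w) w
| fp_cancel b w : fp_eq (inr b :: inr (negb b) :: w) w.

Lemma fp_app u u' v v' : fp_eq u u' -> fp_eq v v' -> fp_eq (u ++ v) (u' ++ v').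
Proof.
  intros H H'. apply fp_trans with (u' ++ v).
  - clear H'. induction H; cbn;
      eauto using fp_refl, fp_sym, fp_trans, fp_cons, fp_mul, fp_one, fp_cancel.
  - clear H. induction u'; cbn; auto using fp_cons.
Qed.

Definition fp_letter_inv (a : G + bool) : G + bool :=
  match a with inl g => inl (g^-1) | inr b => inr (negb b) end.

Lemma fp_letterV a w : fp_eq (fp_letter_inv a :: a :: w) w.
Proof.
  destruct a as [g|b]; cbn.
  - eapply fp_trans; [apply fp_mul|]. rewrite gmulV. apply fp_one.
  - rewrite <- (Bool.negb_involutive b) at 2. apply fp_cancel.
Qed.

Definition fp_inv (w : fword) : fword := rev (map fp_letter_inv w).

Lemma fp_invV w : fp_eq (fp_inv w ++ w) [].
Proof.
  induction w as [|a w IH]; [apply fp_refl|]. unfold fp_inv in *. cbn [map rev].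
  rewrite <- app_assoc. cbn. eapply fp_trans; [|exact IH].
  apply fp_app; [apply fp_refl|apply fp_letterV].
Qed.

Definition freeZ : Grp.
Proof.
  refine (quot fword (@app _) fp_inv [] fp_eq fp_refl fp_sym fp_trans fp_app _ _ fp_invV).
  - intros. rewrite app_assoc. apply fp_refl.
  - intros. apply fp_refl.
Defined.

Definition fcls (w : fword) : freeZ := cls _ fp_eq w.

Lemma fcls_app u v : fcls (u ++ v) = fcls u ** fcls v.
Proof. apply cls_mul. Qed.

Lemma fcls_eq u v : fp_eq u v -> fcls u = fcls v.
Proof. apply cls_eq; [apply fp_sym|apply fp_trans]. Qed.

Definition fz_in (g : G) : freeZ := fcls [inl g].
Definition fz_t : freeZ := fcls [inr false].

Lemma fz_in_hom : hom fz_in.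
Proof.
  intros x y. unfold fz_in. rewrite <- fcls_app. apply fcls_eq, fp_sym, fp_mul.
Qed.

Lemma fz_tV : fcls [inr true] = fz_t^-1.
Proof. apply ginv_unique. unfold fz_t. rewrite <- fcls_app. apply fcls_eq, fp_cancel. Qed.

Lemma fz_ind (P : freeZ -> Prop) :
  (forall g, P (fz_in g)) -> P fz_t -> P (fz_t^-1) ->
  (forall x y, P x -> P y -> P (x ** y)) -> forall x, P x.
Proof.
  intros Hin Ht HtV Hm x. rewrite <- (cls_rep _ fp_eq x).
  generalize (rep _ fp_eq x). intros w. change (P (fcls w)).
  induction w as [|a w IH].
  - rewrite <- (fcls_eq _ _ (fp_one [])). apply Hin.
  - change (a :: w) with ([a] ++ w). rewrite fcls_app. apply Hm; auto.
    destruct a as [g|[]]; [apply Hin| |apply Ht]. now rewrite fz_tV.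
Qed.

(** * Universal property of the free product *)

Section Lift.
Variables (L : Grp) (h : G -> L) (l : L).
Hypothesis Hh : hom h.

Fixpoint fp_eval (w : fword) : L :=
  match w with
  | [] => gone
  | inl g :: w => h g ** fp_eval w
  | inr b :: w => (if b then l^-1 else l) ** fp_eval w
  end.

Lemma fp_eval_eq u v : fp_eq u v -> fp_eval u = fp_eval v.
Proof.
  induction 1 as [| | |a u v _ IH|g k w|w|b w]; cbn; try congruence.
  - destruct a; now rewrite IH.
  - now rewrite Hh, gassoc.
  - now rewrite (hom1 h Hh), gmul1.
  - destruct b; cbn; now grp.
Qed.

Lemma fp_eval_app u v : fp_eval (u ++ v) = fp_eval u ** fp_eval v.
Proof.
  induction u as [|[g|b] u IH]; cbn; [now rewrite gmul1| |]; now rewrite IH, gassoc.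
Qed.

Definition fz_lift (x : freeZ) : L := fp_eval (rep _ fp_eq x).

Lemma fz_lift_cls w : fz_lift (fcls w) = fp_eval w.
Proof. apply fp_eval_eq, rep_cls, fp_refl. Qed.

Lemma fz_lift_hom : hom fz_lift.
Proof.
  intros x y. rewrite <- (cls_rep _ fp_eq x), <- (cls_rep _ fp_eq y).
  change (fz_lift (fcls (rep _ fp_eq x) ** fcls (rep _ fp_eq y)) =
    fz_lift (fcls (rep _ fp_eq x)) ** fz_lift (fcls (rep _ fp_eq y))).
  now rewrite <- fcls_app, !fz_lift_cls, fp_eval_app.
Qed.

Lemma fz_lift_in g : fz_lift (fz_in g) = h g.
Proof. unfold fz_in. rewrite fz_lift_cls. apply gmulr1. Qed.

Lemma fz_lift_t : fz_lift fz_t = l.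
Proof. unfold fz_t. rewrite fz_lift_cls. apply gmulr1. Qed.

End Lift.

(** * Polynomial functions on the free product *)

Definition sgn (b : bool) : Z := if b then -1 else 1.

(* [count w f [f1; ...; fm]] sums, over all ways to select m letters t^(+-1) in w, the product of
   the exponents selected and of the values of f, f1, ..., fm at the G-parts of the m + 1 segments
   between them. It is the corner entry of a unipotent block representation in which t acts by
   1 + T; the condition [good] makes T^2 = 0, so that t^n acts by 1 + nT. *)
Fixpoint count (w : fword) (f : G -> Z) (fs : list (G -> Z)) : Z :=
  match w with
  | [] => match fs with [] => f gone | _ => 0 end
  | inl g :: w => count w (fun x => f (g ** x)) fs
  | inr b :: w =>
      count w f fs + match fs with
                     | [] => 0
                     | f' :: fs' => sgn b * f gone * count w f' fs'
                     end
  end.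

(** All functions of [fs] except the last belong to segments between two selected letters, where an
    empty segment must contribute zero. *)
Fixpoint good (fs : list (G -> Z)) : Prop :=
  match fs with f :: (_ :: _) as fs' => f gone = 0 /\ good fs' | _ => True end.

Lemma good_tail f fs : good (f :: fs) -> good fs.
Proof. destruct fs; cbn; tauto. Qed.

Lemma count_eq u v : fp_eq u v -> forall f fs, good fs -> count u f fs = count v f fs.
Proof.
  induction 1 as [w|u v _ IH|u v w _ IH _ IH'|a u v _ IH|g k w|w|b w]; intros f fs Hfs.
  - reflexivity.
  - symmetry; auto.
  - rewrite IH; auto.
  - destruct a as [g|b]; cbn; [auto|]. rewrite IH by auto. f_equal.
    destruct fs as [|f' fs]; auto. rewrite IH; auto. now apply good_tail in Hfs.
  - cbn. f_equal. apply functional_extensionality. intros x. now rewrite gassoc.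
  - cbn. f_equal. apply functional_extensionality. intros x. now rewrite gmul1.
  (* Selecting exactly one of the two inverse letters gives opposite terms; selecting both leaves an
     empty segment between them, where [good] gives zero. *)
  - cbn [count]. destruct fs as [|f' [|f'' fs]].
    + lia.
    + destruct b; cbn [sgn negb]; lia.
    + destruct Hfs as [-> _]. destruct b; cbn [sgn negb]; lia.
Qed.

Lemma count_sub w : forall (f f' : G -> Z) fs,
  count w (fun x => f x - f' x) fs = count w f fs - count w f' fs.
Proof.
  induction w as [|[g|b] w IH]; intros f f' fs; cbn.
  - destruct fs; lia.
  - apply (IH (fun x => f (g ** x)) (fun x => f' (g ** x))).
  - rewrite IH. destruct fs; lia.
Qed.

Definition fz_count (f : G -> Z) (fs : list (G -> Z)) (x : freeZ) : Z :=
  count (rep _ fp_eq x) f fs.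

Lemma fz_count_cls f fs w : good fs -> fz_count f fs (fcls w) = count w f fs.
Proof. intros H. apply count_eq; auto. apply rep_cls, fp_refl. Qed.

Lemma fz_count_app f fs u x : good fs ->
  fz_count f fs (fcls u ** x) = count (u ++ rep _ fp_eq x) f fs.
Proof.
  intros H. rewrite <- (cls_rep _ fp_eq x) at 1.
  change (cls _ fp_eq (rep _ fp_eq x)) with (fcls (rep _ fp_eq x)).
  now rewrite <- fcls_app, fz_count_cls.
Qed.

(** Induction on [fs] and on the degree of [f]: a difference along G differentiates [f], and the
    difference along t is f(1) times the count for the shorter list. The bound [k] is uniform in
    [f], as the differences of [f] vary with g. *)
Lemma fz_count_Poly fs : good fs -> Forall (fun f => exists d, Poly d f) fs ->
  forall d, exists k, forall f, Poly d f -> Poly k (fz_count f fs).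
Proof.
  induction fs as [|f' fs IHfs]; intros Hg HP d.
  all: induction d as [|d [k IH]].
  1, 3: exists 0%nat; intros f Hf x;
    replace f with (fun x : G => f x - f x)
      by (apply functional_extensionality; intros y; rewrite (Hf y : f y = 0); lia);
    unfold fz_count; rewrite count_sub; lia.
  - exists (S k). intros f Hf x. revert x. apply fz_ind.
    + intros g. refine (Poly_ext _ _ _ _ (IH _ (Hf g))). intros x.
      unfold fz_in. rewrite fz_count_app by easy. apply count_sub.
    + apply (Poly_ext _ (fun _ => 0)); [|apply Poly_zero]. intros x.
      unfold fz_t. rewrite fz_count_app by easy. cbn [app count sgn]. unfold fz_count. lia.
    + apply (Poly_ext _ (fun _ => 0)); [|apply Poly_zero]. intros x.
      rewrite <- fz_tV, fz_count_app by easy. cbn [app count sgn]. unfold fz_count. lia.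
    + intros a b. apply Poly_diff_mul.
  - apply Forall_cons_iff in HP as [[d' Hd'] HP].
    destruct (IHfs (good_tail _ _ Hg) HP d') as [k' IH'].
    exists (S (max k k')). intros f Hf x. revert x.
    assert (Ht : Poly (max k k') (fun x => fz_count f (f' :: fs) (fz_t ** x)
                                          - fz_count f (f' :: fs) x)).
    { refine (Poly_ext _ _ _ _ (Poly_scale _ (f gone) _
        (Poly_le _ _ _ (Nat.le_max_r k k') (IH' _ Hd')))).
      intros x. unfold fz_t. rewrite fz_count_app by easy.
      cbn [app count sgn]. unfold fz_count. lia. }
    apply fz_ind.
    + intros g. apply (Poly_le k); [lia|]. refine (Poly_ext _ _ _ _ (IH _ (Hf g))). intros x.
      unfold fz_in. rewrite fz_count_app by easy. apply count_sub.
    + exact Ht.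
    + now apply Poly_diff_inv.
    + intros a b. apply Poly_diff_mul.
Qed.

(** * Normal forms and separation of elements *)

(* [nf_tail [(b1, n1, g1); ...]] is t^(+-(n1+1)) g1 t^(+-(n2+1)) g2 ..., with signs given by bi. *)
Fixpoint nf_tail (l : list (bool * nat * G)) : fword :=
  match l with
  | [] => []
  | (b, n, g) :: l => repeat (inr b) (S n) ++ inl g :: nf_tail l
  end.

Fixpoint nf_valid (l : list (bool * nat * G)) : Prop :=
  match l with
  | (_, g) :: (_ :: _) as l' => g <> gone /\ nf_valid l'
  | _ => True
  end.

Lemma nf_valid_tail a l : nf_valid (a :: l) -> nf_valid l.
Proof. destruct a, l; cbn; tauto. Qed.

Lemma normal_form w : exists g l, nf_valid l /\ fp_eq w (inl g :: nf_tail l).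
Proof.
  induction w as [|a w (g & l & Hl & IH)].
  { exists gone, []. split; [easy|]. apply fp_sym, fp_one. }
  apply (fp_cons a) in IH. destruct a as [h|b].
  { exists (h ** g), l. split; auto. eapply fp_trans; [apply IH|apply fp_mul]. }
  destruct (classic (l <> [] /\ g = gone)) as [[Hne ->]|Hgen].
  - apply (fun H => fp_trans _ _ _ H (fp_cons _ _ _ (fp_one _))) in IH.
    destruct l as [|[[b' n] g] l]; [easy|].
    destruct (Bool.bool_dec b b') as [->|Hb].
    + exists gone, ((b', S n, g) :: l). split; [destruct l; exact Hl|].
      eapply fp_trans; [apply IH|]. apply fp_sym, fp_one.
    + assert (E : b' = negb b) by now destruct b, b'.
      subst b'. cbn [nf_tail repeat app] in IH.
      apply (fun H => fp_trans _ _ _ H (fp_cancel _ _)) in IH.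
      destruct n as [|n].
      * exists g, l. split; [eapply nf_valid_tail, Hl|exact IH].
      * exists gone, ((negb b, n, g) :: l). split; [destruct l; exact Hl|].
        eapply fp_trans; [apply IH|]. apply fp_sym, fp_one.
  - exists gone, ((b, 0%nat, g) :: l). split.
    + destruct l; [exact I|]. split; [|exact Hl]. intros ->. now apply Hgen.
    + eapply fp_trans; [apply IH|]. apply fp_sym, fp_one.
Qed.

Lemma count_power b n w f f' fs : good (f' :: fs) ->
  count (repeat (inr b) n ++ w) f (f' :: fs) =
  count w f (f' :: fs) + sgn b * Z.of_nat n * f gone * count w f' fs.
Proof.
  intros Hg. induction n as [|n IH]; [cbn; lia|].
  cbn [repeat app count]. rewrite IH.
  (* A second selection in the same power contributes f'(1) = 0, or has no function left. *)
  assert (E : f gone * count (repeat (inr b) n ++ w) f' fs = f gone * count w f' fs).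
  { f_equal. clear IH. induction n as [|n IH]; [easy|]. cbn [repeat app count]. rewrite IH.
    destruct fs as [|f'' fs]; [lia|]. cbn in Hg. destruct Hg as [-> _]. lia. }
  rewrite <- (Z.mul_assoc (sgn b) (f gone)), E, Nat2Z.inj_succ. lia.
Qed.

(** With fewer powers than selections, two selections fall into one power, and the empty segment
    between them contributes zero. *)
Lemma count_too_many l : forall g f fs, good fs -> (length l < length fs)%nat ->
  count (inl g :: nf_tail l) f fs = 0.
Proof.
  induction l as [|[[b n] h] l IH]; intros g f [|f' fs] Hg Hlen;
    cbn [length] in Hlen; try lia; [easy|].
  cbn [nf_tail count]. rewrite count_power, IH, IH by (cbn; eauto using good_tail; lia). lia.
Qed.

(** With as many selections as powers, each power is selected from exactly once, so [c] is the
    product of the signed exponents and of the values of the chosen functions at the segments. *)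
Lemma count_separates l : poly_separated G -> nf_valid l ->
  exists fs, length fs = length l /\ good fs /\ Forall (fun f => exists d, Poly d f) fs /\
    exists c, c <> 0 /\ forall g f, count (inl g :: nf_tail l) f fs = c * f g.
Proof.
  intros HG. induction l as [|[[b n] h] l IH]; intros Hl.
  { exists []. repeat split; auto. exists 1. split; [easy|]. intros g f.
    cbn [nf_tail count]. rewrite gmulr1. lia. }
  destruct (IH (nf_valid_tail _ _ Hl)) as (fs & Hlen & Hg & HP & c & Hc & IHc).
  (* The last segment may be trivial, but [good] leaves its function free, so the constant 1 serves;
     for an inner segment a separating polynomial is shifted to vanish at 1. *)
  assert (Hf1 : exists f1 d, Poly d f1 /\ f1 h <> 0 /\ (l = [] \/ f1 gone = 0)).
  { destruct l as [|a l].
    - exists (fun _ => 1), 1%nat. repeat split; auto using Poly_const. easy.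
    - destruct (HG h (proj1 Hl)) as (d & f & Hf & E).
      exists (fun x => f x - f gone), (S d). repeat split; [|lia|right; lia].
      apply Poly_sub; [now apply Poly_S|].
      apply (Poly_le 1); [lia|apply Poly_const]. }
  destruct Hf1 as (f1 & d & Hf1 & Hh & Hone).
  assert (Hg' : good (f1 :: fs)).
  { destruct fs; [exact I|]. split; [|exact Hg]. now destruct Hone as [->|]. }
  exists (f1 :: fs). split; [cbn; congruence|]. split; [exact Hg'|]. split; [eauto|].
  exists (sgn b * Z.of_nat (S n) * (c * f1 h)). split.
  { destruct b; cbn [sgn]; nia. }
  intros g f. cbn [nf_tail count]. rewrite count_power by exact Hg'.
  (* Skipping the first power leaves too many selections for the rest. *)
  rewrite count_too_many by (auto; cbn; lia). rewrite IHc, gmulr1. lia.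
Qed.

Theorem freeZ_poly_separated : poly_separated G -> poly_separated freeZ.
Proof.
  intros HG x Hx. rewrite <- (cls_rep _ fp_eq x) in *.
  change (cls _ fp_eq (rep _ fp_eq x)) with (fcls (rep _ fp_eq x)) in *.
  destruct (normal_form (rep _ fp_eq x)) as (g & l & Hl & E).
  apply fcls_eq in E. rewrite E in *. clear E. clear x.
  destruct l as [|a l].
  - assert (Hne : g <> gone).
    { intros ->. apply Hx. exact (hom1 _ fz_in_hom). }
    destruct (HG g Hne) as (d & f & Hf & E).
    destruct (fz_count_Poly [] I (Forall_nil _) d) as [k Hk].
    exists k, (fz_count f []). split; [now apply Hk|].
    change gone with (fcls []). rewrite !fz_count_cls by easy. cbn. now rewrite gmulr1.
  - destruct (count_separates _ HG Hl) as (fs & Hlen & Hg & HP & c & Hc & E).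
    destruct (fz_count_Poly fs Hg HP 1%nat) as [k Hk].
    (* With f = 1 on the first segment the normal form counts [c], while the empty word counts 0
       because [fs] is nonempty. *)
    exists k, (fz_count (fun _ => 1) fs). split; [apply Hk, Poly_const|].
    change gone with (fcls []). rewrite !fz_count_cls, E by easy.
    destruct fs; [easy|]. cbn. lia.
Qed.

End FreeProduct.

(** * Free groups of rank two and three *)

Lemma fz_in_V (G : Grp) (x : G) : fz_in G (x^-1) = (fz_in G x)^-1.
Proof. apply homV, fz_in_hom. Qed.

Definition F1 : Grp := freeZ trivial_group.
Definition F2 : Grp := freeZ F1.
Definition F3 : Grp := freeZ F2.

Lemma trivial_poly_separated : poly_separated trivial_group.
Proof. intros []. now intros []. Qed.

Lemma F2_poly_separated : poly_separated F2.
Proof. repeat apply freeZ_poly_separated. apply trivial_poly_separated. Qed.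

Lemma F3_poly_separated : poly_separated F3.
Proof. apply freeZ_poly_separated, F2_poly_separated. Qed.

(** [gq], [gw] generate the acting group, [gu], [gv], [gc] the normal factor; [F3] being built from
    [F2], [gu] and [gv] are copies of [gq] and [gw]. *)
Definition gq : F2 := fz_in _ (fz_t _).
Definition gw : F2 := fz_t _.
Definition gu : F3 := fz_in _ gq.
Definition gv : F3 := fz_in _ gw.
Definition gc : F3 := fz_t _.

Lemma F2_ind (P : F2 -> Prop) :
  P gq -> P gw -> (forall x, P x -> P (x^-1)) -> (forall x y, P x -> P y -> P (x ** y)) ->
  forall x, P x.
Proof.
  intros Hq Hw HV Hm. apply fz_ind; auto.
  apply fz_ind; auto.
  - intros [].
    assert (E : fz_in F1 (fz_in trivial_group tt) = gone).
    { exact (eq_trans (f_equal _ (hom1 _ (fz_in_hom _))) (hom1 _ (fz_in_hom _))). }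
    rewrite E. change (P (@gone F2)). rewrite <- (gmulV F2 gq). auto.
  - rewrite fz_in_V. apply HV, Hq.
  - intros x y Hx Hy. rewrite fz_in_hom. auto.
Qed.

Lemma F3_ind (P : F3 -> Prop) :
  P gu -> P gv -> P gc -> (forall x, P x -> P (x^-1)) ->
  (forall x y, P x -> P y -> P (x ** y)) -> forall x, P x.
Proof.
  intros Hu Hv Hc HV Hm. apply fz_ind; auto.
  apply F2_ind; auto.
  - intros x Hx. rewrite fz_in_V. auto.
  - intros x y Hx Hy. rewrite fz_in_hom. auto.
Qed.

Lemma F3_hom_ext (L : Grp) (f g : F3 -> L) : hom f -> hom g ->
  f gu = g gu -> f gv = g gv -> f gc = g gc -> forall x, f x = g x.
Proof.
  intros Hf Hg Hu Hv Hc. apply F3_ind; auto.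
  - intros x Hx. now rewrite !homV, Hx.
  - intros x y Hx Hy. now rewrite Hf, Hg, Hx, Hy.
Qed.

Definition lift2 {L : Grp} (a b : L) : F2 -> L :=
  fz_lift F1 L (fz_lift trivial_group L (fun _ => gone) a) b.

Lemma lift2_hom {L : Grp} (a b : L) : hom (lift2 a b).
Proof. do 2 apply fz_lift_hom. intros x y. now rewrite gmul1. Qed.

Lemma lift2_q {L : Grp} (a b : L) : lift2 a b gq = a.
Proof.
  unfold lift2, gq. rewrite fz_lift_in; [apply fz_lift_t|apply fz_lift_hom];
    intros x y; now rewrite gmul1.
Qed.

Lemma lift2_w {L : Grp} (a b : L) : lift2 a b gw = b.
Proof. apply fz_lift_t, fz_lift_hom. intros x y. now rewrite gmul1. Qed.

Definition lift3 {L : Grp} (a b c : L) : F3 -> L := fz_lift F2 L (lift2 a b) c.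

Lemma lift3_hom {L : Grp} (a b c : L) : hom (lift3 a b c).
Proof. apply fz_lift_hom, lift2_hom. Qed.

Lemma lift3_u {L : Grp} (a b c : L) : lift3 a b c gu = a.
Proof. unfold lift3, gu. now rewrite fz_lift_in, lift2_q by apply lift2_hom. Qed.

Lemma lift3_v {L : Grp} (a b c : L) : lift3 a b c gv = b.
Proof. unfold lift3, gv. now rewrite fz_lift_in, lift2_w by apply lift2_hom. Qed.

Lemma lift3_c {L : Grp} (a b c : L) : lift3 a b c gc = c.
Proof. apply fz_lift_t, lift2_hom. Qed.

Ltac lift := repeat (rewrite ?lift3_u, ?lift3_v, ?lift3_c, ?lift2_q, ?lift2_w,
                       ?lift3_hom, ?homV by apply lift3_hom).

Lemma F3_IA (f : F3 -> F3) : hom f ->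
  abeq (f gu) gu -> abeq (f gv) gv -> abeq (f gc) gc -> IA f.
Proof.
  intros Hf Hu Hv Hc. unfold IA. apply F3_ind; auto.
  - intros x Hx. rewrite homV by easy. now apply abeq_inv.
  - intros x y Hx Hy. rewrite Hf. now apply abeq_mul.
Qed.

Lemma F3_inverse (f g : F3 -> F3) : hom f -> hom g ->
  f (g gu) = gu -> f (g gv) = gv -> f (g gc) = gc -> forall x, f (g x) = x.
Proof.
  intros Hf Hg Hu Hv Hc. apply (F3_hom_ext F3 (fun x => f (g x)) (fun x => x)); auto.
  - intros x y. now rewrite Hg, Hf.
  - easy.
Qed.

(** * PV_3 as the free product of F_3 x| F_2 with Z *)

(** Conjugation by q: c q u = u c q gives q u q^-1 = c^-1 u c, and q commutes with v and c. *)
Definition act_q : IAut F3.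
Proof.
  refine (Build_IAut F3 (lift3 (gc^-1 ** gu ** gc) gv gc) (lift3 (gc ** gu ** gc^-1) gv gc)
    (lift3_hom _ _ _) (lift3_hom _ _ _) _ _ _ _).
  1, 2: apply F3_inverse; try apply lift3_hom; lift; now grp.
  1, 2: apply F3_IA; try apply lift3_hom; lift; try apply abeq_refl.
  - apply abeq_conj.
  - rewrite <- (ginvK gc) at 1. apply abeq_conj.
Defined.

(** Conjugation by w: u v w c = c v u w gives w c w^-1 = (uv)^-1 c v u, and w commutes with u and
    v. *)
Definition act_w : IAut F3.
Proof.
  refine (Build_IAut F3 (lift3 gu gv ((gu ** gv)^-1 ** gc ** gv ** gu))
    (lift3 gu gv (gu ** gv ** gc ** (gv ** gu)^-1))
    (lift3_hom _ _ _) (lift3_hom _ _ _) _ _ _ _).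
  1, 2: apply F3_inverse; try apply lift3_hom; lift; now grp.
  1, 2: apply F3_IA; try apply lift3_hom; lift; try apply abeq_refl.
  (* Modulo commutators (uv)^-1 may be replaced by (vu)^-1, which leaves a conjugate of c. *)
  - apply abeq_trans with ((gv ** gu)^-1 ** gc ** (gv ** gu)); [|apply abeq_conj].
    rewrite (gassoc _ gv gu).
    do 2 (apply abeq_mul; [|apply abeq_refl]). apply abeq_inv, abeq_comm.
  - apply abeq_trans with ((gv ** gu)^-1^-1 ** gc ** (gv ** gu)^-1); [|apply abeq_conj].
    rewrite ginvK. do 2 (apply abeq_mul; [|apply abeq_refl]). apply abeq_comm.
Defined.

Definition act : F2 -> IAut_grp F3 := lift2 (L := IAut_grp F3) act_q act_w.

Lemma act_hom : hom act.
Proof. apply lift2_hom. Qed.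

Definition F3F2 : Grp := semidirect F3 F2 act act_hom.
Definition K : Grp := freeZ F3F2.

Lemma K_poly_separated : poly_separated K.
Proof.
  apply freeZ_poly_separated, semidirect_poly_separated;
    [apply F3_poly_separated|apply F2_poly_separated].
Qed.

Lemma act_fun_q x : act_fun F3 F2 act gq x = ia_fun F3 act_q x.
Proof. unfold act_fun, act. now rewrite lift2_q. Qed.

Lemma act_fun_w x : act_fun F3 F2 act gw x = ia_fun F3 act_w x.
Proof. unfold act_fun, act. now rewrite lift2_w. Qed.

(** * The hexagon relations and the relations of the factors *)

Definition hexagon {L : Grp} (x0 x1 x2 x3 x4 x5 : L) (a : Gen) : L :=
  match a with l12 => x0 | l13 => x1 | l23 => x2 | l21 => x3 | l31 => x4 | l32 => x5 end.

Definition flips {L : Grp} (x y z : L) : Prop := x ** (y ** z) = z ** (y ** x).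

(** Each ordering (k, i, j) gives three consecutive vertices of the hexagon, read backwards in three
    of the six cases. *)
Lemma respects_hexagon {L : Grp} (f : Gen -> L) :
  respects_rels f <->
  flips (f l12) (f l13) (f l23) /\ flips (f l13) (f l23) (f l21) /\
  flips (f l23) (f l21) (f l31) /\ flips (f l21) (f l31) (f l32) /\
  flips (f l31) (f l32) (f l12) /\ flips (f l32) (f l12) (f l13).
Proof.
  unfold flips. split.
  - intros H.
    pose proof (H I1 I2 I3) as H0. pose proof (H I2 I1 I3) as H1.
    pose proof (H I2 I3 I1) as H2. pose proof (H I3 I2 I1) as H3.
    pose proof (H I3 I1 I2) as H4. pose proof (H I1 I3 I2) as H5.
    cbn in *. rewrite !gmulr1 in *. repeat split;
      first [now apply H0|now apply H2|now apply H4|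
             symmetry; first [now apply H1|now apply H3|now apply H5]].
  - intros (H0 & H1 & H2 & H3 & H4 & H5) k i j Hki Hkj Hij.
    destruct k, i, j; try congruence; cbn; rewrite !gmulr1; congruence.
Qed.

Section Relations.
Variables (L : Grp) (u v c q w t : L).
Hypothesis Hqu : c ** q ** u = u ** (c ** q).
Hypothesis Hqv : q ** v = v ** q.
Hypothesis Hqc : q ** c = c ** q.
Hypothesis Hwu : w ** u = u ** w.
Hypothesis Hwv : w ** v = v ** w.
Hypothesis Hwc : u ** v ** w ** c = c ** v ** u ** w.

(** The inner letters t cancel in every product, so each flip becomes a relation among u, v, c, q,
    w. The third flip is the one that rests on [Hwc]. *)
Lemma relations_to_hexagon :
  respects_rels (hexagon t (t^-1 ** (c ** q)) ((c ** q)^-1 ** u ** t) (t^-1 ** w)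
                         (v ** q^-1 ** t) (t^-1 ** q)).
Proof.
  apply respects_hexagon. cbn [hexagon].
  assert (E1 : (c ** q)^-1 ** u ** (c ** q) = u).
  { now rewrite gassoc, <- Hqu, gmulK. }
  assert (E2 : q ** v ** q^-1 = v) by (rewrite Hqv; now grp).
  unfold flips. repeat split.
  - transitivity (u ** t); [now grp|]. rewrite <- E1 at 1. now grp.
  - transitivity (t^-1 ** (u ** w)); [now grp|]. rewrite <- Hwu. rewrite <- E1 at 1. now grp.
  - transitivity ((c ** q)^-1 ** (u ** w ** v ** q^-1) ** t); [now grp|].
    transitivity ((c ** q)^-1 ** (c ** (q ** v ** q^-1) ** w ** q^-1 ** c^-1 ** u) ** t);
      [|now grp].
    do 2 f_equal. rewrite E2.
    transitivity (u ** w ** v ** c ** (q^-1 ** c^-1)).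
    + rewrite !gassoc. do 3 f_equal. rewrite <- ginvM, <- Hqc, ginvM. now grp.
    + assert (E3 : u ** w ** v ** c = c ** v ** w ** u).
      { now rewrite (gassoc u w v), Hwv, gmulA, Hwc, gassoc, <- Hwu, gmulA. }
      rewrite E3. transitivity (c ** v ** w ** (u ** (c ** q)^-1)); [now grp|].
      transitivity (c ** v ** w ** ((c ** q)^-1 ** u)); [|now grp].
      f_equal. rewrite <- E1 at 1. now grp.
  - transitivity (t^-1 ** (w ** v)); [now grp|]. rewrite Hwv. rewrite <- E2 at 1. now grp.
  - transitivity (v ** t); [now grp|]. rewrite <- E2 at 1. now grp.
  - transitivity (t^-1 ** (q ** c ** q)); [now grp|]. rewrite Hqc. now grp.
Qed.

End Relations.

Section HexagonToRelations.
Variables (L : Grp) (x0 x1 x2 x3 x4 x5 : L).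
Hypotheses (R0 : flips x0 x1 x2) (R1 : flips x1 x2 x3) (R2 : flips x2 x3 x4)
  (R3 : flips x3 x4 x5) (R4 : flips x4 x5 x0) (R5 : flips x5 x0 x1).

(** The formulas for x1, ..., x5 solved for u, v, c and, in [beta], for q, w, with t = x0. *)
Definition alpha : F3 -> L :=
  lift3 (x0 ** x1 ** x2 ** x0^-1) (x4 ** x5) (x0 ** x1 ** x5^-1 ** x0^-1).
Definition beta : F2 -> L := lift2 (x0 ** x5) (x0 ** x3).

Lemma flips_mul (x y z a : L) : flips x y z -> x ** (y ** (z ** a)) = z ** (y ** (x ** a)).
Proof. intros H. now rewrite (gmulA _ y z a), gmulA, H, !gassoc. Qed.

Lemma alpha_beta q x : beta q ** alpha x = alpha (act_fun F3 F2 act q x) ** beta q.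
Proof.
  (* Stated as conjugation, the claim is multiplicative in both [q] and [x] and so reduces to
     generators. *)
  enough (H : forall q x, alpha (act_fun F3 F2 act q x) = beta q ** alpha x ** (beta q)^-1).
  { rewrite H. now grp. }
  clear q x.
  assert (Ha : hom alpha) by apply lift3_hom.
  assert (Hb : hom beta) by apply lift2_hom.
  pose proof (fun a => flips_mul _ _ _ a R0) as S0.
  pose proof (fun a => flips_mul _ _ _ a R2) as S2.
  pose proof (fun a => flips_mul _ _ _ a R3) as S3.
  pose proof (fun a => flips_mul _ _ _ a R4) as S4.
  pose proof (fun a => flips_mul _ _ _ a R5) as S5.
  assert (Eu : x0 ** x1 ** x2 ** x0^-1 = x2 ** x1).
  { grp. rewrite S0. now grp. }
  unfold flips in *.
  assert (gen : forall (q : F2) (e : IAut F3), (forall x, act_fun F3 F2 act q x = ia_fun F3 e x) ->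
    (forall g, g = gu \/ g = gv \/ g = gc -> alpha (ia_fun F3 e g) ** beta q = beta q ** alpha g) ->
    forall x, alpha (act_fun F3 F2 act q x) = beta q ** alpha x ** (beta q)^-1).
  { intros q e Hq Hg.
    assert (Hg' : forall g, g = gu \/ g = gv \/ g = gc ->
        alpha (act_fun F3 F2 act q g) = beta q ** alpha g ** (beta q)^-1).
    { intros g H. rewrite <- Hg, Hq by easy. now grp. }
    apply F3_hom_ext; auto.
    - intros x y. now rewrite act_mulF, Ha.
    - intros x y. rewrite Ha. now grp. }
  apply (F2_ind (fun q => forall x,
    alpha (act_fun F3 F2 act q x) = beta q ** alpha x ** (beta q)^-1)).
  - apply (gen _ _ act_fun_q). unfold alpha, beta.
    intros g [-> | [-> | ->]]; cbn [ia_fun act_q]; lift; rewrite ?Eu; grp.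
    + rewrite <- S0. now grp.
    + apply S4.
    + rewrite S5. now grp.
  - apply (gen _ _ act_fun_w). unfold alpha, beta.
    intros g [-> | [-> | ->]]; cbn [ia_fun act_w]; lift; rewrite ?Eu.
    + grp. now rewrite <- S0, R1.
    + grp. now rewrite S4, R3.
    (* Multiplying by the image of u v clears the inverse of u v in the image of c under w; both
       sides then equal one positive word. *)
    + apply (gmul_cancel (x2 ** x1 ** (x4 ** x5))).
      transitivity (x0 ** (x1 ** (x4 ** (x3 ** (x2 ** x1))))); grp.
      * rewrite <- (S0 x3), S4. grp. now rewrite R1.
      * symmetry. rewrite S4, <- S0, <- S3, S5. grp. now rewrite S2.
  - intros q Hq x.
    set (y := act_fun F3 F2 act (q^-1) x).
    assert (E : x = act_fun F3 F2 act q y).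
    { unfold y. rewrite <- act_mulQ, gmulVr by apply act_hom. symmetry. apply act_oneQ, act_hom. }
    rewrite E, Hq, (homV beta q Hb). now grp.
  - intros q r Hq Hr x. rewrite act_mulQ, Hq, Hr, Hb by apply act_hom. now grp.
Qed.

End HexagonToRelations.

(** * Maps between PV_3 and the free product *)

Definition emb_left (x : F3) : K := fz_in F3F2 (sd_left F3 F2 act act_hom x).
Definition emb_right (q : F2) : K := fz_in F3F2 (sd_right F3 F2 act act_hom q).

Lemma emb_left_hom : hom emb_left.
Proof. intros x y. unfold emb_left, K. now rewrite sd_left_hom, fz_in_hom. Qed.

Lemma emb_right_left q x :
  emb_right q ** emb_left x = emb_left (act_fun F3 F2 act q x) ** emb_right q.
Proof. unfold emb_left, emb_right, K. rewrite <- !fz_in_hom.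
  exact (f_equal _ (sd_right_left F3 F2 act act_hom q x)). Qed.

Definition pv3_to_K : Gen -> K :=
  let u := emb_left gu in let v := emb_left gv in let c := emb_left gc in
  let q := emb_right gq in let w := emb_right gw in let t := fz_t F3F2 : K in
  hexagon t (t^-1 ** (c ** q)) ((c ** q)^-1 ** u ** t) (t^-1 ** w)
          (v ** q^-1 ** t) (t^-1 ** q).

Lemma pv3_to_K_respects : respects_rels pv3_to_K.
Proof.
  assert (V : forall x, emb_left (x^-1) = (emb_left x)^-1) by (intros; apply homV, emb_left_hom).
  apply relations_to_hexagon; rewrite ?gassoc, ?emb_right_left, ?act_fun_q, ?act_fun_w;
    cbn [ia_fun act_q act_w]; lift; rewrite ?emb_left_hom, ?V, ?emb_left_hom; now grp.
Qed.

(** The universal properties of the factors give the map out of [K]. When L is PV_3 itself, it is a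
    left inverse of PV_3 -> K, which is therefore injective. *)
Lemma pv3_to_K_retract (L : Grp) (f : Gen -> L) : respects_rels f ->
  exists h : K -> L, hom h /\ forall x, h (pv3_to_K x) = f x.
Proof.
  intros Hf. apply respects_hexagon in Hf as (R0 & R1 & R2 & R3 & R4 & R5).
  pose (al := alpha L (f l12) (f l13) (f l23) (f l31) (f l32)).
  pose (be := beta L (f l12) (f l21) (f l32)).
  pose (h4 := fun x : F3F2 => al (fst x) ** be (snd x)).
  assert (Ha : hom al) by apply lift3_hom.
  assert (Hb : hom be) by apply lift2_hom.
  assert (H4 : hom h4).
  { apply sd_lift_hom; auto. intros q x. now apply alpha_beta. }
  pose (h := fz_lift F3F2 L h4 (f l12)).
  assert (Hh : hom h) by now apply fz_lift_hom.
  assert (Hl : forall x, h (emb_left x) = al x).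
  { intros x. unfold h, emb_left. rewrite fz_lift_in by exact H4.
    change (al x ** be gone = al x). now rewrite (hom1 be Hb), gmulr1. }
  assert (Hr : forall x, h (emb_right x) = be x).
  { intros x. unfold h, emb_right. rewrite fz_lift_in by exact H4.
    change (al gone ** be x = be x). now rewrite (hom1 al Ha), gmul1. }
  assert (Ht : h (fz_t F3F2 : K) = f l12) by now apply fz_lift_t.
  assert (HV : forall x, h (x^-1) = (h x)^-1) by (intros; now apply homV).
  exists h. split; [exact Hh|].
  intros x; destruct x; cbn [pv3_to_K hexagon];
    rewrite ?Hh, ?HV, ?Hh, ?Hl, ?Hr, ?Ht; auto; unfold al, be, alpha, beta; lift; now grp.
Qed.

(** * The group PV_3 *)

Lemma pv3_app_l u v w : pv3_eq u v -> pv3_eq (w ++ u) (w ++ v).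
Proof.
  induction 1; eauto using pv3_refl, pv3_sym, pv3_trans; rewrite !(app_assoc w);
    [apply pv3_cancel|now apply pv3_rel].
Qed.

Lemma pv3_app_r u v w : pv3_eq u v -> pv3_eq (u ++ w) (v ++ w).
Proof.
  induction 1; eauto using pv3_refl, pv3_sym, pv3_trans; rewrite <- !app_assoc;
    [apply pv3_cancel|now apply pv3_rel].
Qed.

Lemma pv3_app u u' v v' : pv3_eq u u' -> pv3_eq v v' -> pv3_eq (u ++ v) (u' ++ v').
Proof. eauto using pv3_trans, pv3_app_l, pv3_app_r. Qed.

Definition word_inv (w : word) : word := rev (map (fun a => (fst a, negb (snd a))) w).

Lemma word_invV w : pv3_eq (word_inv w ++ w) [].
Proof.
  induction w as [|[x b] w IH]; [apply pv3_refl|].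
  unfold word_inv in *. cbn [map rev fst snd]. rewrite <- app_assoc.
  eapply pv3_trans; [|exact IH].
  pose proof (pv3_cancel (rev (map (fun a => (fst a, negb (snd a))) w)) w x (negb b)) as E.
  rewrite Bool.negb_involutive in E. exact E.
Qed.

Definition PV3 : Grp.
Proof.
  refine (quot word (@app _) word_inv [] pv3_eq pv3_refl pv3_sym pv3_trans pv3_app _ _ word_invV).
  - intros. rewrite app_assoc. apply pv3_refl.
  - intros. apply pv3_refl.
Defined.

Definition wcls (w : word) : PV3 := cls word pv3_eq w.

Lemma wcls_app u v : wcls (u ++ v) = wcls u ** wcls v.
Proof. apply cls_mul. Qed.

Lemma wcls_eq u v : wcls u = wcls v <-> pv3_eq u v.
Proof. split; [apply cls_inj, pv3_refl|apply cls_eq; [apply pv3_sym|apply pv3_trans]]. Qed.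

Lemma eval_wcls w : eval (fun x => wcls (letter x)) w = wcls w.
Proof.
  induction w as [|[x b] w IH]; [reflexivity|]. cbn [eval]. rewrite IH.
  change ((x, b) :: w) with ([(x, b)] ++ w). rewrite wcls_app. f_equal.
  destruct b; [|reflexivity]. symmetry. apply ginv_unique. unfold letter.
  rewrite <- wcls_app. apply wcls_eq. exact (pv3_cancel [] [] x false).
Qed.

Lemma letter_respects : respects_rels (fun x => wcls (letter x)).
Proof.
  intros k i j Hki Hkj Hij. rewrite !eval_wcls. apply wcls_eq.
  pose proof (pv3_rel [] [] k i j Hki Hkj Hij) as E. now rewrite !app_nil_r in E.
Qed.

Lemma pv3_to_K_injective w : eval pv3_to_K w = gone -> pv3_eq w [].
Proof.
  intros E. destruct (pv3_to_K_retract PV3 _ letter_respects) as (h & Hh & Hx).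
  apply wcls_eq. rewrite <- eval_wcls. apply functional_extensionality in Hx.
  rewrite <- Hx, <- hom_eval, E by easy. exact (hom1 h Hh).
Qed.

(** PV_3 is residually torsion-free nilpotent: every nontrivial element
    (a word not equal to 1 in PV_3) survives in some torsion-free nilpotent
    quotient, i.e. has nontrivial image under some homomorphism PV_3 -> H with
    H torsion-free nilpotent. *)
Theorem theorem2p2 :
  forall w : word, ~ pv3_eq w nil ->
    exists (H : Grp) (f : Gen -> H),
      torsion_free H /\ nilpotent H /\ respects_rels f /\ eval f w <> gone.
Proof.
  intros w Hw.
  (* The image of [w] is separated from 1 in [K]; the index [k] of the separating polynomial selects
     the quotient. *)
  destruct (K_poly_separated (eval pv3_to_K w)) as (k & p & Hp & Hne).
  { intros E. apply Hw. now apply pv3_to_K_injective. }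
  exists (poly_quot K k), (fun x => pcls K k (pv3_to_K x)).
  pose proof (pcls_hom K k) as Hc.
  split; [|split; [|split]].
  - apply poly_quot_torsion_free.
  - apply poly_quot_nilpotent.
  - intros a i j Hai Haj Hij. rewrite <- !hom_eval by exact Hc. f_equal.
    now apply pv3_to_K_respects.
  - rewrite <- hom_eval, <- (hom1 _ Hc) by exact Hc. intros E. apply pcls_eq in E.
    apply Hne. specialize (E p Hp gone). now rewrite gmulr1, gmul1 in E.
Qed.
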